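(* Let $\delta:\mathbb{N}\to\mathbb{N}$ be a sequence of positive integers, let $\mathcal{F}=\mathcal{F}^\delta$ be the algebra of matrix sequences with dimension function $\delta$, and let $\mathcal{A}$ be a separable $C^*$-subalgebra of $\mathcal{F}$. Then there is a strictly increasing sequence $\eta:\mathbb{N}\to\mathbb{N}$ such that the restricted algebra $\mathcal{A}_\eta=R_\eta\mathcal{A}$ is an essentially fractal subalgebra of $\mathcal{F}_\eta=\mathcal{F}^{\delta\circ\eta}$.
   Context: $\mathcal{F}=\mathcal{F}^\delta$ is the $C^*$-algebra of all bounded sequences $(A_n)$ of matrices $A_n\in\mathbb{C}^{\delta(n)\times\delta(n)}$ (pointwise operations, supremum norm). The ideal $\mathcal{K}$ of compact sequences is the smallest closed ideal of $\mathcal{F}$ containing all sequences $(K_n)\in\mathcal{F}$ with $\operatorname{rank}K_n\le 1$ for all $n$; equivalently, $(A_n)\in\mathcal{K}$ iff for every $\varepsilon>0$ there is $(K_n)\in\mathcal{F}$ with $\sup_n\|A_n-K_n\|<\varepsilon$ and $\sup_n\operatorname{rank}K_n<\infty$. For a strictly increasing $\eta:\mathbb{N}\to\mathbb{N}$, let $R_\eta:(A_n)\mapsto(A_{\eta(n)})$ be the restriction map from $\mathcal{F}^\delta$ onto $\mathcal{F}_\eta:=\mathcal{F}^{\delta\circ\eta}$, and for $\mathcal{B}\subseteq\mathcal{F}$ write $\mathcal{B}_\eta:=R_\eta(\mathcal{B})$. ($\mathcal{K}_\eta$ is the ideal of compact sequences of $\mathcal{F}_\eta$.) A $^*$-homomorphism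 $W:\mathcal{A}\to\mathcal{B}$ on a $C^*$-subalgebra $\mathcal{A}$ of $\mathcal{F}$ is fractal if for every strictly increasing $\eta$ there is a mapping $W_\eta:\mathcal{A}_\eta\to\mathcal{B}$ with $W=W_\eta R_\eta|_{\mathcal{A}}$. A $C^*$-subalgebra $\mathcal{A}$ of $\mathcal{F}$ is essentially fractal if the canonical homomorphism $\mathcal{A}\to\mathcal{A}/(\mathcal{A}\cap\mathcal{K})$ is fractal and $(\mathcal{A}\cap\mathcal{K})_\eta=\mathcal{A}_\eta\cap\mathcal{K}_\eta$ for every strictly increasing $\eta$. Essential fractality of a $C^*$-subalgebra of $\mathcal{F}^{\delta\circ\eta}$ is defined in the same way, with dimension function $\delta\circ\eta$ in place of $\delta$. *)

(* Defs.v *)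
(* The complex numbers are R[i] for R : realType. *)
From HB Require Import structures.
From mathcomp Require Import all_boot all_order all_algebra.
From mathcomp Require Import spectral.
From mathcomp Require Import complex.
From mathcomp Require Import boolp classical_sets functions cardinality reals.

Set Implicit Arguments.
Unset Strict Implicit.
Unset Printing Implicit Defensive.

Import Order.TTheory GRing.Theory Num.Theory.
Local Open Scope ring_scope.
Local Open Scope classical_set_scope.
Local Open Scope complex_scope.
Local Open Scope sesquilinear_scope.

Definition l2norm (R : realType) (m : nat) (x : 'cV[R[i]]_m) : R :=
  Num.sqrt (\sum_(k < m) ComplexField.Normc.normc (x k 0) ^+ 2).

(* The C*-norm of a matrix: operator norm with respect to the Euclidean norm. *)
Definition opnorm (R : realType) (m : nat) (M : 'M[R[i]]_m) : R :=
  sup [set l2norm (M *m x) | x in [set x : 'cV[R[i]]_m | l2norm x <= 1]].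

(* All sequences of matrices of sizes delta n; F^delta is the subset [Fseq]. *)
Definition matseq (R : realType) (delta : nat -> nat) : Type :=
  forall n : nat, 'M[R[i]]_(delta n).

Section Operations.
Context {R : realType} {delta : nat -> nat}.
Implicit Types X Y : matseq R delta.

Definition mszero : matseq R delta := fun n => 0.
Definition msadd X Y : matseq R delta := fun n => X n + Y n.
Definition mssub X Y : matseq R delta := fun n => X n - Y n.
Definition msscale (c : R[i]) X : matseq R delta := fun n => c *: X n.
Definition msmul X Y : matseq R delta := fun n => X n *m Y n.
Definition msadj X : matseq R delta := fun n => X n ^t*.

(* Junk value 0 on unbounded sequences: only meaningful on [Fseq]. *)
Definition supnorm X : R := sup [set opnorm (X n) | n in [set: nat]].

End Operations.

Definition Fseq (R : realType) (delta : nat -> nat) : set (matseq R delta) :=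
  [set X | exists c : R, forall n, opnorm (X n) <= c].

Section Subalgebras.
Context {R : realType} {delta : nat -> nat}.
Implicit Types S D J A : set (matseq R delta).

Definition norm_closed S : Prop :=
  forall X, Fseq X ->
    (forall e : R, 0 < e -> exists2 Y, S Y & supnorm (mssub X Y) < e) -> S X.

(* No unit is required. *)
Record cstar_subalgebra A : Prop := CstarSubalgebra {
  cstar_sub : A `<=` @Fseq R delta;
  cstar_zero : A mszero;
  cstar_add : forall X Y, A X -> A Y -> A (msadd X Y);
  cstar_scale : forall c X, A X -> A (msscale c X);
  cstar_mul : forall X Y, A X -> A Y -> A (msmul X Y);
  cstar_adj : forall X, A X -> A (msadj X);
  cstar_closed : norm_closed A }.

Definition separable A : Prop :=
  exists D, [/\ countable D, D `<=` A &
    forall X, A X ->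
      forall e : R, 0 < e -> exists2 Y, D Y & supnorm (mssub X Y) < e].

Record closed_ideal J : Prop := ClosedIdeal {
  ideal_sub : J `<=` @Fseq R delta;
  ideal_zero : J mszero;
  ideal_add : forall X Y, J X -> J Y -> J (msadd X Y);
  ideal_scale : forall c X, J X -> J (msscale c X);
  ideal_mull : forall X Y, Fseq X -> J Y -> J (msmul X Y);
  ideal_mulr : forall X Y, J X -> Fseq Y -> J (msmul X Y);
  ideal_closed : norm_closed J }.

End Subalgebras.

Definition rank_le1_seq (R : realType) (delta : nat -> nat) :
    set (matseq R delta) :=
  [set X | Fseq X /\ forall n, (\rank (X n) <= 1)%N].

Definition Kseq (R : realType) (delta : nat -> nat) : set (matseq R delta) :=
  smallest (@closed_ideal R delta) (@rank_le1_seq R delta).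

Definition strictly_increasing (eta : nat -> nat) : Prop :=
  forall m n, (m < n)%N -> (eta m < eta n)%N.

Definition restr (R : realType) (delta : nat -> nat) (eta : nat -> nat)
    (X : matseq R delta) : matseq R (delta \o eta) :=
  fun n => X (eta n).

Section Fractality.
Context {R : realType} {delta : nat -> nat}.
Implicit Types A I : set (matseq R delta).

(* W, of which only the values on A matter, is a map from A to B. *)
Definition fractal A (T : Type) (B : set T) (W : matseq R delta -> T) : Prop :=
  forall eta, strictly_increasing eta ->
    exists Weta : matseq R (delta \o eta) -> T,
      set_fun (restr eta @` A) B Weta /\
      forall X, A X -> W X = Weta (restr eta X).

Definition coset I (X : matseq R delta) : set (matseq R delta) :=
  [set msadd X Y | Y in I].

(* The quotient A / I as the set of cosets X + I with X in A; the canonical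
   map A -> A / I is [coset I]. *)
Definition quotient A I : set (set (matseq R delta)) := coset I @` A.

Definition essentially_fractal A : Prop :=
  [/\ cstar_subalgebra A,
      fractal A (quotient A (A `&` @Kseq R delta))
                (coset (A `&` @Kseq R delta)) &
      forall eta, strictly_increasing eta ->
        restr eta @` (A `&` @Kseq R delta) =
        (restr eta @` A) `&` @Kseq R (delta \o eta)].

End Fractality.

(* Main.v *)
(* Compact sequences are those which, for each e > 0, lie within e of a bounded
   sequence of bounded rank. For fixed X, r and e, whether X_n lies within e of
   a matrix of rank at most r is a predicate of n; by a diagonal argument, eta
   makes all of these eventually constant for X in a countable dense subset of
   A and e = 1/(q+1). If a further restriction of X_eta is compact, the relevant
   predicates hold infinitely often, hence eventually, along eta; the finitely
   many remaining entries have finite rank, so X_eta itself is compact. This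
   gives both requirements of essential fractality.
   That A_eta is norm closed holds for every eta: if |X_(eta n)| <= c for all n,
   then X' = X (1 - tau X^* X)^k with k tau c^2 = 1/4 and k large lies in A,
   agrees with X along eta up to c/4 and satisfies |X'_n| <= 2 c for all n,
   so limits along eta lift to A through a geometric series. *)
Require Import Defs.
From mathcomp Require Import all_boot all_order all_algebra.
From mathcomp Require Import spectral complex.
From mathcomp Require Import boolp classical_sets functions cardinality reals.
From mathcomp Require Import ring lra.

Set Implicit Arguments.
Unset Strict Implicit.
Unset Printing Implicit Defensive.

Import Order.TTheory GRing.Theory Num.Theory.
Local Open Scope ring_scope.
Local Open Scope classical_set_scope.
Local Open Scope complex_scope.
Local Open Scope sesquilinear_scope.

(** * The Euclidean norm and the operator norm *)

Section RealInnerProduct.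
Context {R : realType}.
Local Notation C := R[i].
Local Notation normc := (@ComplexField.Normc.normc R).

Lemma normc_sqr (z : C) : normc z ^+ 2 = complex.Re z ^+ 2 + complex.Im z ^+ 2.
Proof. by case: z => a b /=; rewrite sqr_sqrtr // addr_ge0 ?sqr_ge0. Qed.

Lemma normc_ge0 (z : C) : 0 <= normc z.
Proof. by case: z => a b /=; rewrite sqrtr_ge0. Qed.

Lemma trmxC_mul m n p (M : 'M[C]_(m, n)) (N : 'M[C]_(n, p)) :
  (M *m N)^t* = N^t* *m M^t*.
Proof. by rewrite trmx_mul map_mxM. Qed.

(** Real part of the Hermitian inner product: a symmetric real bilinear form with the same norm,
    which keeps estimates in [R]. *)
Definition rdot m (u v : 'cV[C]_m) : R := complex.Re ((u^t* *m v) 0 0).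

Lemma ReD (x y : C) : complex.Re (x + y) = complex.Re x + complex.Re y.
Proof. by case: x y => [a b] [c d]. Qed.

Lemma rdotC m (u v : 'cV[C]_m) : rdot u v = rdot v u.
Proof.
rewrite /rdot -[v in LHS]trmxCK -trmxC_mul !mxE.
by case: (\sum_j _) => a b.
Qed.

Lemma rdotDr m (u v w : 'cV[C]_m) : rdot u (v + w) = rdot u v + rdot u w.
Proof. by rewrite /rdot mulmxDr mxE ReD. Qed.

Lemma rdotNr m (u v : 'cV[C]_m) : rdot u (- v) = - rdot u v.
Proof. by rewrite /rdot mulmxN mxE; case: (_ 0 0). Qed.

Lemma rdotZr m (a : R) (u v : 'cV[C]_m) : rdot u (a%:C *: v) = a * rdot u v.
Proof.
by rewrite /rdot -scalemxAr mxE; case: (_ 0 0) => x y /=; rewrite mul0r subr0.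
Qed.

Lemma rdotDl m (u v w : 'cV[C]_m) : rdot (v + w) u = rdot v u + rdot w u.
Proof. by rewrite rdotC rdotDr !(rdotC u). Qed.

Lemma rdotNl m (u v : 'cV[C]_m) : rdot (- v) u = - rdot v u.
Proof. by rewrite rdotC rdotNr (rdotC u). Qed.

Lemma rdotZl m (a : R) (u v : 'cV[C]_m) : rdot (a%:C *: v) u = a * rdot v u.
Proof. by rewrite rdotC rdotZr (rdotC u). Qed.

Lemma rdot_adj m n (M : 'M[C]_(m, n)) (u : 'cV[C]_n) (v : 'cV[C]_m) :
  rdot (M *m u) v = rdot u (M^t* *m v).
Proof. by rewrite /rdot trmxC_mul mulmxA. Qed.

Lemma l2norm_ge0 m (u : 'cV[C]_m) : 0 <= l2norm u.
Proof. exact: sqrtr_ge0. Qed.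

Lemma l2norm_sqr m (u : 'cV[C]_m) : l2norm u ^+ 2 = rdot u u.
Proof.
rewrite /l2norm sqr_sqrtr ?sumr_ge0 // => [|k _]; last by rewrite sqr_ge0.
rewrite /rdot mxE.
have -> : complex.Re (\sum_j (u^t*) 0 j * u j 0) =
    \sum_j complex.Re ((u^t*) 0 j * u j 0).
  by elim/big_rec2: _ => [//|j x y _ <-]; rewrite ReD.
apply: eq_bigr => k _; rewrite normc_sqr !mxE.
by case: (u k 0) => a b /=; rewrite mulNr opprK !expr2.
Qed.

Lemma mul_adj_self m (u : 'cV[C]_m) : u^t* *m u = ((l2norm u ^+ 2)%:C)%:M.
Proof.
apply/matrixP => i j; rewrite !ord1 [RHS]mxE eqxx l2norm_sqr /rdot.
(* Self-adjointness kills the imaginary part of the single entry. *)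
have : (u^t* *m u)^t* = u^t* *m u by rewrite trmxC_mul trmxCK.
move=> /matrixP/(_ 0 0); rewrite 2!mxE; case: (_ 0 0) => a b [] /eqP.
by rewrite eq_sym -addr_eq0 -mulr2n mulrn_eq0 /= => /eqP->.
Qed.

Lemma l2norm_entry m (u : 'cV[C]_m) k : normc (u k 0) <= l2norm u.
Proof.
rewrite -(ler_pXn2r (n := 2)) ?nnegrE ?normc_ge0 ?l2norm_ge0 //.
rewrite /l2norm sqr_sqrtr ?sumr_ge0 // => [|j _]; last by rewrite sqr_ge0.
by rewrite (bigD1 k) //= lerDl sumr_ge0 // => j _; rewrite sqr_ge0.
Qed.

Lemma l2norm0 m : l2norm (0 : 'cV[C]_m) = 0.
Proof.
by apply/eqP; rewrite -sqrf_eq0 l2norm_sqr /rdot mulmx0 mxE.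
Qed.

Lemma l2norm_eq0 m (u : 'cV[C]_m) : l2norm u = 0 -> u = 0.
Proof.
move=> u0; apply/matrixP => k j; rewrite ord1 mxE.
apply: ComplexField.Normc.eq0_normc; apply: le_anti.
by rewrite normc_ge0 -u0 l2norm_entry.
Qed.

Lemma l2normZ m (a : C) (u : 'cV[C]_m) : l2norm (a *: u) = normc a * l2norm u.
Proof.
have h x : 0 <= x -> x = Num.sqrt (x ^+ 2) :> R.
  by move=> x0; rewrite sqrtr_sqr ger0_norm.
rewrite [normc a]h ?normc_ge0 // /l2norm -sqrtrM ?sqr_ge0 // mulr_sumr.
congr Num.sqrt; apply: eq_bigr => k _.
by rewrite mxE ComplexField.Normc.normcM exprMn.
Qed.

Lemma normc_real (a : R) : 0 <= a -> normc a%:C = a.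
Proof. by move=> a0; rewrite /= expr0n addr0 sqrtr_sqr ger0_norm. Qed.

Lemma rdot_le m (u v : 'cV[C]_m) : rdot u v <= l2norm u * l2norm v.
Proof.
have [a0|] := ltP 0 (l2norm u); last first.
  move=> u0; have /l2norm_eq0-> : l2norm u = 0.
    by apply/le_anti; rewrite u0 l2norm_ge0.
  by rewrite rdotC /rdot mulmx0 mxE l2norm0 mul0r.
have [b0|] := ltP 0 (l2norm v); last first.
  move=> v0; have /l2norm_eq0-> : l2norm v = 0.
    by apply/le_anti; rewrite v0 l2norm_ge0.
  by rewrite /rdot mulmx0 mxE l2norm0 mulr0.
set a := l2norm u in a0 *; set b := l2norm v in b0 *.
(* Expanding the square leaves [2 * (a * b) * (a * b - rdot u v)]; dividing by the positive [a * b]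
   gives Cauchy-Schwarz. *)
have : 0 <= l2norm (b%:C *: u - a%:C *: v) ^+ 2 by rewrite sqr_ge0.
rewrite l2norm_sqr !(rdotDl, rdotDr, rdotNl, rdotNr, rdotZl, rdotZr).
rewrite -!l2norm_sqr -/a -/b (rdotC v u) => h.
have ab0 : 0 < a * b by rewrite mulr_gt0.
rewrite -(ler_pM2l ab0); nra.
Qed.

Lemma ler_l2normD m (u v : 'cV[C]_m) : l2norm (u + v) <= l2norm u + l2norm v.
Proof.
have := l2norm_ge0 u; have := l2norm_ge0 v => v0 u0.
rewrite -(ler_pXn2r (n := 2)) ?nnegrE ?addr_ge0 ?l2norm_ge0 //.
rewrite l2norm_sqr !(rdotDl, rdotDr) -!l2norm_sqr (rdotC v u).
have := rdot_le u v; nra.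
Qed.

Lemma l2normN m (u : 'cV[C]_m) : l2norm (- u) = l2norm u.
Proof.
apply/eqP; rewrite -(eqrXn2 (n := 2)) ?l2norm_ge0 //.
by rewrite !l2norm_sqr rdotNl rdotNr opprK.
Qed.

Lemma ler_l2norm_sum m (I : Type) (r : seq I) (F : I -> 'cV[C]_m) :
  l2norm (\sum_(i <- r) F i) <= \sum_(i <- r) l2norm (F i).
Proof.
elim/big_rec2: _ => [|i y x _ le]; first by rewrite l2norm0.
by apply: (le_trans (ler_l2normD _ _)); rewrite lerD2l.
Qed.

End RealInnerProduct.

(** * Operator norm estimates and completeness of matrices *)

Section OperatorNorm.
Context {R : realType}.
Local Notation C := R[i].
Local Notation normc := (@ComplexField.Normc.normc R).

Lemma l2norm_le_sum m (x : 'cV[C]_m) : l2norm x <= \sum_k normc (x k 0).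
Proof.
have {1}-> : x = \sum_k x k 0 *: delta_mx k 0.
  by rewrite {1}[x]matrix_sum_delta; apply: eq_bigr => k _; rewrite big_ord1.
apply: (le_trans (ler_l2norm_sum _ _)); apply: ler_sum => k _.
rewrite l2normZ -[leRHS]mulr1 ler_wpM2l ?normc_ge0 //.
rewrite -(ler_pXn2r (n := 2)) ?nnegrE ?l2norm_ge0 //.
rewrite l2norm_sqr /rdot trmx_delta map_delta_mx mul_delta_mx mxE /=.
by rewrite expr1n.
Qed.

(** Crude, but enough to make the supremum in [opnorm] finite and to turn entrywise convergence into
    norm convergence. *)
Lemma l2norm_mulmx_le_sum m n (M : 'M[C]_(m, n)) (x : 'cV[C]_n) :
  l2norm (M *m x) <= (\sum_i \sum_j normc (M i j)) * l2norm x.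
Proof.
apply: (le_trans (l2norm_le_sum _)); rewrite mulr_suml.
apply: ler_sum => i _; rewrite mxE mulr_suml.
apply: (@le_trans _ _ (\sum_j normc (M i j * x j 0))).
  elim/big_rec2: _ => [|j a b _ le]; first by rewrite ComplexField.Normc.normc0.
  by apply: (le_trans (le_normcD _ _)); rewrite lerD2l.
apply: ler_sum => j _; rewrite ComplexField.Normc.normcM.
by apply: ler_wpM2l; [apply: normc_ge0 | apply: l2norm_entry].
Qed.

Section Square.
Variable m : nat.
Implicit Types (M N : 'M[C]_m) (x : 'cV[C]_m).

Let values M : set R :=
  [set l2norm (M *m x) | x in [set x : 'cV[C]_m | l2norm x <= 1]].

Lemma opnorm_has_sup M : has_sup (values M).
Proof.
split; first by exists (l2norm (M *m 0)), 0 => //=; rewrite l2norm0 ler01.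
exists (\sum_i \sum_j normc (M i j)) => _ [x /= x1 <-].
apply: (le_trans (l2norm_mulmx_le_sum _ _)).
rewrite -[leRHS]mulr1 ler_wpM2l // !sumr_ge0 // => i _.
by rewrite sumr_ge0 // => j _; apply: normc_ge0.
Qed.

Lemma opnorm_ge0 M : 0 <= opnorm M.
Proof.
apply: (@le_trans _ _ (l2norm (M *m 0))); first exact: l2norm_ge0.
apply: sup_upper_bound; first exact: opnorm_has_sup.
by exists 0 => //=; rewrite l2norm0 ler01.
Qed.

Lemma opnormP M x : l2norm (M *m x) <= opnorm M * l2norm x.
Proof.
have [x0|] := ltP 0 (l2norm x); last first.
  move=> u0; have /l2norm_eq0-> : l2norm x = 0.
    by apply/le_anti; rewrite u0 l2norm_ge0.
  by rewrite mulmx0 l2norm0 mulr0.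
rewrite -ler_pdivrMr //.
have inv0 : 0 <= (l2norm x)^-1 by rewrite invr_ge0 ltW.
have -> : l2norm (M *m x) / l2norm x = l2norm (M *m ((l2norm x)^-1%:C *: x)).
  by rewrite -scalemxAr l2normZ normc_real // mulrC.
apply: sup_upper_bound; first exact: opnorm_has_sup.
exists ((l2norm x)^-1%:C *: x) => //=.
by rewrite l2normZ normc_real // mulVf ?gt_eqF.
Qed.

Lemma opnorm_le M (c : R) : 0 <= c ->
  (forall x, l2norm (M *m x) <= c * l2norm x) -> opnorm M <= c.
Proof.
move=> c0 h; apply: ge_sup; first by case: (opnorm_has_sup M).
by move=> _ [x /= x1 <-]; rewrite (le_trans (h x)) // -[leRHS]mulr1 ler_wpM2l.
Qed.

Lemma opnorm0 : opnorm (0 : 'M[C]_m) = 0.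
Proof.
apply/le_anti; rewrite opnorm_ge0 andbT; apply: opnorm_le => // x.
by rewrite mul0mx l2norm0 mul0r.
Qed.

Lemma ler_opnormD M N : opnorm (M + N) <= opnorm M + opnorm N.
Proof.
apply: opnorm_le => [|x]; first by rewrite addr_ge0 ?opnorm_ge0.
by rewrite mulmxDl mulrDl (le_trans (ler_l2normD _ _)) // lerD ?opnormP.
Qed.

Lemma opnormZ_le (a : C) M : opnorm (a *: M) <= normc a * opnorm M.
Proof.
apply: opnorm_le => [|x]; first by rewrite mulr_ge0 ?opnorm_ge0 ?normc_ge0.
by rewrite -scalemxAl l2normZ -mulrA ler_wpM2l ?normc_ge0 ?opnormP.
Qed.

Lemma opnormN M : opnorm (- M) = opnorm M.
Proof.
have h N : opnorm (- N) <= opnorm N.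
  apply: opnorm_le => [|x]; first exact: opnorm_ge0.
  by rewrite mulNmx l2normN opnormP.
apply/le_anti/andP; split; first exact: h.
by rewrite -{1}[M]opprK; apply: h.
Qed.

Lemma opnormBC M N : opnorm (M - N) = opnorm (N - M).
Proof. by rewrite -opnormN opprB. Qed.

Lemma ler_opnormB M N P : opnorm (M - P) <= opnorm (M - N) + opnorm (N - P).
Proof. by apply: le_trans (ler_opnormD _ _); rewrite addrA subrK. Qed.

Lemma opnormM_le M N : opnorm (M *m N) <= opnorm M * opnorm N.
Proof.
apply: opnorm_le => [|x]; first by rewrite mulr_ge0 ?opnorm_ge0.
rewrite -mulmxA -mulrA (le_trans (opnormP _ _)) //.
by rewrite ler_wpM2l ?opnorm_ge0 ?opnormP.
Qed.

(** With y = M^* x one has |y|^2 = <M y, x> <= |M| |y| |x|, and |y| cancels. *)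
Lemma opnorm_adj_le M : opnorm (M^t*) <= opnorm M.
Proof.
apply: opnorm_le => [|x]; first exact: opnorm_ge0.
have [x0|] := ltP 0 (l2norm (M^t* *m x)); last first.
  by move=> h; apply: (le_trans h); rewrite mulr_ge0 ?opnorm_ge0 ?l2norm_ge0.
rewrite -(ler_pM2l x0) -expr2 l2norm_sqr -rdot_adj.
rewrite (le_trans (rdot_le _ _)) // mulrA ler_wpM2r ?l2norm_ge0 //.
by rewrite mulrC [leRHS]mulrC mulrC opnormP.
Qed.

(** Here |M x|^2 = <x, M x>, so Cauchy-Schwarz bounds |M x| by |x|. *)
Lemma opnorm_proj_le M : M^t* = M -> M *m M = M -> opnorm M <= 1.
Proof.
move=> Ma MM; apply: opnorm_le => // x.
have [x0|] := ltP 0 (l2norm (M *m x)); last first.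
  by move=> h; apply: (le_trans h); rewrite mul1r l2norm_ge0.
rewrite -(ler_pM2l x0) -expr2 l2norm_sqr rdot_adj Ma mulmxA MM mul1r mulrC.
by rewrite rdot_le.
Qed.

Lemma normc_entry_le M i j : normc (M i j) <= opnorm M.
Proof.
have -> : M i j = (M *m delta_mx j 0) i (0 : 'I_1) by rewrite -colE mxE.
rewrite (le_trans (l2norm_entry _ _)) // (le_trans (opnormP _ _)) //.
rewrite -[leRHS]mulr1 ler_wpM2l ?opnorm_ge0 //.
rewrite -(ler_pXn2r (n := 2)) ?nnegrE ?l2norm_ge0 //.
rewrite l2norm_sqr /rdot trmx_delta map_delta_mx mul_delta_mx mxE /=.
by rewrite expr1n.
Qed.

Lemma opnorm_le_sum M : opnorm M <= \sum_i \sum_j normc (M i j).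
Proof.
apply: opnorm_le => [|x]; last exact: l2norm_mulmx_le_sum.
by rewrite !sumr_ge0 // => i _; rewrite sumr_ge0 // => j _; apply: normc_ge0.
Qed.

End Square.

(* The limit of [u] is the supremum of the lower bounds [u k - e k]. *)
Lemma real_seq_lim (u e : nat -> R) :
  (forall k l, (k <= l)%N -> `|u k - u l| <= e k) ->
  exists a, forall k, `|u k - a| <= e k.
Proof.
move=> h.
have le k l : u k - e k <= u l + e l.
  case: (leqP k l) => [kl|/ltnW lk].
    have := h k l kl; have := h l l (leqnn l); rewrite subrr normr0 ler_norml.
    by move=> e0 /andP[a b]; lra.
  have := h l k lk; have := h k k (leqnn k); rewrite subrr normr0 ler_norml.
  by move=> e0 /andP[a b]; lra.
pose S := range (fun k => u k - e k).
have S0 : S !=set0 by exists (u 0%N - e 0%N); exists 0%N.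
have Ssup : has_sup S.
  by split => //; exists (u 0%N + e 0%N) => _ [k _ <-]; apply: le.
exists (sup S) => k.
have h1 : u k - e k <= sup S by apply: sup_upper_bound => //; exists k.
have h2 : sup S <= u k + e k by apply: ge_sup => // _ [l _ <-]; apply: le.
by rewrite ler_norml; apply/andP; split; lra.
Qed.

Lemma normc_ge_ReIm (z : C) :
  `|complex.Re z| <= normc z /\ `|complex.Im z| <= normc z.
Proof.
by split; rewrite -(ler_pXn2r (n := 2)) ?nnegrE ?normr_ge0 ?normc_ge0 //;
  rewrite normc_sqr real_normK ?num_real // ?lerDl ?lerDr sqr_ge0.
Qed.

Lemma normc_le_ReIm (z : C) : normc z <= `|complex.Re z| + `|complex.Im z|.
Proof.
rewrite -(ler_pXn2r (n := 2)) ?nnegrE ?addr_ge0 ?normc_ge0 //.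
rewrite normc_sqr sqrrD !real_normK ?num_real // lerD2r lerDl.
by rewrite mulrn_wge0 // mulr_ge0.
Qed.

(** Completeness with the rate [e] unchanged: a constant depending on [m] would spoil uniformity in
    [n] later, where the sizes [delta n] may be unbounded. *)
Lemma matrix_seq_lim m (M : nat -> 'M[C]_m) (e : nat -> R) :
  (forall d, 0 < d -> exists k, forall l, (k <= l)%N -> e l < d) ->
  (forall k l, (k <= l)%N -> opnorm (M k - M l) <= e k) ->
  exists L, forall k, opnorm (M k - L) <= e k.
Proof.
move=> e0 h.
have limE (p : C -> R) : (forall x y, p (x - y) = p x - p y) ->
    (forall z, `|p z| <= normc z) -> forall i j,
    exists a, forall k, `|p (M k i j) - a| <= e k.
  move=> pB pn i j; apply: real_seq_lim => k l kl.
  rewrite -pB (le_trans (pn _)) //.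
  have -> : M k i j - M l i j = (M k - M l) i j by rewrite !mxE.
  by rewrite (le_trans (normc_entry_le _ _ _)) ?h.
have [||a ha] := choice (fun ij => limE (@complex.Re R) _ _ ij.1 ij.2).
- by case=> ? ? [].
- by move=> z; case: (normc_ge_ReIm z).
have [||b hb] := choice (fun ij => limE (@complex.Im R) _ _ ij.1 ij.2).
- by case=> ? ? [].
- by move=> z; case: (normc_ge_ReIm z).
pose L := \matrix_(i, j) (a (i, j) +i* b (i, j)).
(* Entrywise limits alone cost a factor [2 * m ^ 2]. *)
have hL l : opnorm (M l - L) <= (m * m)%:R * (2 * e l).
  apply: (le_trans (opnorm_le_sum _)).
  have -> : (m * m)%:R * (2 * e l) = \sum_(i < m) \sum_(j < m) (2 * e l).
    under eq_bigr => i _ do rewrite sumr_const card_ord.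
    by rewrite sumr_const card_ord -mulrnA mulr_natl.
  apply: ler_sum => i _; apply: ler_sum => j _.
  rewrite (le_trans (normc_le_ReIm _)) // mulr2n mulrDl mul1r !mxE.
  have := ha (i, j) l; have := hb (i, j) l.
  by case: (M l i j) => x y /= *; apply: lerD.
exists L => k; apply/ler_addgt0Pr => d d0.
pose c : R := (m * m)%:R * 2 + 1.
have c0 : 0 < c by rewrite ltr_wpDl // mulr_ge0.
have [l0 hl0] := e0 (d / c) (divr_gt0 d0 c0).
(* Passing through a far term [M l] absorbs that factor into the arbitrary [d]. *)
pose l := maxn k l0.
have el0 : 0 <= e l by apply: le_trans (h l l (leqnn _)); apply: opnorm_ge0.
apply: (le_trans (ler_opnormB _ (M l) _)).
apply: lerD; first by apply: h; rewrite leq_maxl.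
apply: (le_trans (hL l)); rewrite mulrA.
have := hl0 l (leq_maxr _ _); rewrite ltr_pdivlMr // => /ltW; apply: le_trans.
by rewrite mulrC ler_wpM2l // lerDl.
Qed.

End OperatorNorm.

(** * Compact sequences *)

Section CompactSequences.
Context {R : realType}.
Local Notation C := R[i].
Local Notation normc := (@ComplexField.Normc.normc R).

Section FixedDimension.
Variable delta : nat -> nat.
Implicit Types X Y Z : matseq R delta.

Lemma Fseq_add X Y : Fseq X -> Fseq Y -> Fseq (msadd X Y).
Proof.
move=> [a ha] [b hb]; exists (a + b) => n.
by rewrite (le_trans (ler_opnormD _ _)) // lerD.
Qed.

Lemma Fseq_scale c X : Fseq X -> Fseq (msscale c X).
Proof.
move=> [a ha]; exists (normc c * a) => n.
by rewrite (le_trans (opnormZ_le _ _)) // ler_wpM2l ?normc_ge0.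
Qed.

Lemma Fseq_sub X Y : Fseq X -> Fseq Y -> Fseq (mssub X Y).
Proof.
move=> [a ha] [b hb]; exists (a + b) => n.
by rewrite (le_trans (ler_opnormD _ _)) // opnormN lerD.
Qed.

Lemma Fseq_mul X Y : Fseq X -> Fseq Y -> Fseq (msmul X Y).
Proof.
move=> [a ha] [b hb]; exists (a * b) => n.
by rewrite (le_trans (opnormM_le _ _)) // ler_pM ?opnorm_ge0.
Qed.

Lemma opnorm_le_supnorm X n : Fseq X -> opnorm (X n) <= supnorm X.
Proof.
move=> [c hc]; apply: sup_upper_bound; last by exists n.
by split; [exists (opnorm (X 0%N)), 0%N | exists c => _ [k _ <-]].
Qed.

Lemma supnorm_le X (c : R) : (forall n, opnorm (X n) <= c) -> supnorm X <= c.
Proof.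
move=> h; apply: ge_sup; first by exists (opnorm (X 0%N)), 0%N.
by move=> _ [n _ <-].
Qed.

(* The paper's epsilon-rank description of the compact sequences. *)
Definition rank_approximable X : Prop :=
  forall e : R, 0 < e -> exists r : nat, forall n,
    exists2 K : 'M[C]_(delta n), (\rank K <= r)%N & opnorm (X n - K) <= e.

(** Makes every member of [Kseq] rank approximable. Ranks of approximants add under sums and do not
    grow under scalars and products; a limit borrows the approximants of a nearby sequence. *)
Lemma rank_approximable_closed_ideal :
  closed_ideal [set X | Fseq X /\ rank_approximable X].
Proof.
split=> [X []//|||c X|X Y|X Y|X FX happ] /=.
- split; first by exists 0 => n; rewrite opnorm0.
  move=> e e0; exists 0%N => n.
  by exists 0; rewrite ?mxrank0 ?subrr ?opnorm0 // ltW.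
- move=> X Y [FX aX] [FY aY]; split; first exact: Fseq_add.
  move=> e e0; have e20 : 0 < e / 2 by rewrite divr_gt0.
  have [r hr] := aX _ e20; have [s hs] := aY _ e20.
  exists (r + s)%N => n; have [K rK hK] := hr n; have [L rL hL] := hs n.
  exists (K + L); first by rewrite (leq_trans (mxrank_add _ _)) // leq_add.
  rewrite opprD addrACA [e]splitr; apply: (le_trans (ler_opnormD _ _)).
  by apply: lerD; [exact: hK | exact: hL].
- move=> [FX aX]; split; first exact: Fseq_scale.
  (* The tolerance is divided by the modulus plus 1, as the modulus itself may be 0. *)
  move=> e e0; have c0 : 0 < normc c + 1 by rewrite ltr_wpDl ?normc_ge0.
  have [r hr] := aX _ (divr_gt0 e0 c0).
  exists r => n; have [K rK hK] := hr n.
  exists (c *: K); first by rewrite (leq_trans (mxrank_scale _ _)).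
  rewrite -scalerBr (le_trans (opnormZ_le _ _)) //.
  rewrite (ler_pdivlMr _ _ c0) in hK; apply: le_trans hK.
  rewrite [leRHS]mulrC.
  by rewrite ler_wpM2r ?opnorm_ge0 // lerDl.
- move=> FX [FY aY]; split; first exact: Fseq_mul.
  move=> e e0; have [c hc] := FX.
  have c0 : 0 < c + 1 by rewrite ltr_wpDl // (le_trans _ (hc 0%N)) ?opnorm_ge0.
  have [r hr] := aY _ (divr_gt0 e0 c0).
  exists r => n; have [K rK hK] := hr n.
  exists (X n *m K); first by rewrite (leq_trans (mxrankM_maxr _ _)).
  rewrite -mulmxBr (le_trans (opnormM_le _ _)) //.
  rewrite (ler_pdivlMr _ _ c0) in hK; apply: le_trans hK.
  rewrite [leRHS]mulrC.
  by rewrite ler_wpM2r ?opnorm_ge0 // (le_trans (hc n)) // lerDl.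
- move=> [FX aX] FY; split; first exact: Fseq_mul.
  move=> e e0; have [c hc] := FY.
  have c0 : 0 < c + 1 by rewrite ltr_wpDl // (le_trans _ (hc 0%N)) ?opnorm_ge0.
  have [r hr] := aX _ (divr_gt0 e0 c0).
  exists r => n; have [K rK hK] := hr n.
  exists (K *m Y n); first by rewrite (leq_trans (mxrankM_maxl _ _)).
  rewrite -mulmxBl (le_trans (opnormM_le _ _)) //.
  move: hK; rewrite (ler_pdivlMr _ _ c0); apply: le_trans.
  by rewrite ler_wpM2l ?opnorm_ge0 // (le_trans (hc n)) // lerDl.
- split=> // e e0; have e20 : 0 < e / 2 by rewrite divr_gt0.
  have [Y [FY aY] hY] := happ _ e20.
  have [r hr] := aY _ e20.
  exists r => n; have [K rK hK] := hr n; exists K => //.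
  rewrite [e]splitr; apply: (le_trans (ler_opnormB _ (Y n) _)).
  apply: lerD; last exact: hK.
  exact: le_trans (opnorm_le_supnorm n (Fseq_sub FX FY)) (ltW hY).
Qed.

Lemma Kseq_rank_approximable X : Kseq X -> Fseq X /\ rank_approximable X.
Proof.
move=> KX; apply: (KX [set Y | Fseq Y /\ rank_approximable Y]).
split; first exact: rank_approximable_closed_ideal.
move=> Y [FY rY]; split=> // e e0; exists 1%N => n.
by exists (Y n); rewrite ?rY ?subrr ?opnorm0 // ltW.
Qed.

(** An intersection of closed ideals is one; boundedness of its members comes from one particular
    ideal, that of [rank_approximable_closed_ideal]. *)
Lemma Kseq_closed_ideal : closed_ideal (@Kseq R delta).
Proof.
split=> [X|J JP|X Y KX KY J JP|c X KX J JP|X Y FX KY J JP|X Y KX FY J JP|].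
- by move=> /Kseq_rank_approximable[].
- by apply: ideal_zero; case: JP.
- by apply: ideal_add; [case: JP | apply: KX | apply: KY].
- by apply: ideal_scale; [case: JP | apply: KX].
- by apply: ideal_mull; [case: JP | | apply: KY].
- by apply: ideal_mulr; [case: JP | apply: KX |].
- move=> X FX h J JP; apply: (ideal_closed JP.1) => // e e0.
  by have [Y KY XY] := h e e0; exists Y => //; apply: KY.
Qed.

(* P is the orthogonal projection onto the conjugate of a nonzero row of M. *)
Lemma rank_reduction m (M : 'M[C]_m) (r : nat) : (\rank M <= r.+1)%N ->
  exists P : 'M[C]_m, [/\ opnorm P <= 1, (\rank P <= 1)%N
                        & (\rank (M - M *m P)%R <= r)%N].
Proof.
move=> rM; have [->|M0] := eqVneq M 0.
  by exists 0; rewrite opnorm0 ler01 mxrank0 mul0mx subr0 mxrank0.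
have [i Mi0] : exists i, row i M != 0.
  apply/existsP; apply: contraR M0 => /existsPn h; apply/eqP/row_matrixP => i.
  by rewrite row0; apply/eqP; rewrite -[_ == _]negbK h.
pose v := row i M.
pose s := l2norm (v^t*).
have s0 : 0 < s.
  rewrite lt_neqAle l2norm_ge0 andbT eq_sym.
  apply: contra Mi0 => /eqP/l2norm_eq0 h.
  by rewrite -/v -[v]trmxCK h trmx0 map_mx0.
pose w : 'rV[C]_m := (s^-1)%:C *: v.
have ww : w *m w^t* = 1%:M.
  rewrite -{1}[w]trmxCK mul_adj_self.
  have -> : w^t* = (s^-1)%:C *: v^t*.
    apply/matrixP => j k; rewrite !mxE rmorphM.
    by congr (_ * _); apply: conjc_real.
  by rewrite l2normZ normc_real ?invr_ge0 ?(ltW s0) // mulVf ?gt_eqF // expr1n.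
exists (w^t* *m w); split.
- apply: opnorm_proj_le; first by rewrite trmxC_mul trmxCK.
  by rewrite mulmxA -(mulmxA _ w) ww mulmx1.
- by rewrite (leq_trans (mxrankM_maxr _ _)) // rank_leq_row.
set Q := 1%:M - w^t* *m w.
have -> : M - M *m (w^t* *m w) = M *m Q by rewrite mulmxBr mulmx1.
(* Multiplying by [Q] lowers the rank by the dimension of the row space of [M] met with the kernel
   of [Q], and that intersection contains the nonzero [w]. *)
rewrite -ltnS (leq_trans _ rM) // -(mxrank_mul_ker M Q) -addn1 leq_add2l.
have wk : (w <= M :&: kermx Q)%MS.
  rewrite sub_capmx scalemx_sub ?row_sub //=; apply/sub_kermxP.
  by rewrite mulmxBr mulmx1 mulmxA ww mul1mx subrr.
rewrite (leq_trans _ (mxrankS wk)) // lt0n mxrank_eq0.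
apply/negP => /eqP w0; move: ww; rewrite w0 mul0mx => /matrixP/(_ 0 0).
by rewrite !mxE eqxx => /esym/eqP; rewrite oner_eq0.
Qed.

(** Induction on [r], splitting X = (X - X P) + X P. The projections have norm at most 1, so [P] is
    a bounded sequence of rank at most 1 and X P lies in the ideal. *)
Lemma bounded_rank_Kseq r X :
  Fseq X -> (forall n, (\rank (X n) <= r)%N) -> Kseq X.
Proof.
elim: r X => [|r IH] X FX rX.
  apply: sub_gen_smallest; split=> // n.
  by apply: leq_trans (rX n) _.
pose P n := sval (cid (rank_reduction (rX n))).
have hP n := svalP (cid (rank_reduction (rX n))).
have FP : Fseq (P : matseq R delta) by exists 1 => n; case: (hP n).
have -> : X = msadd (mssub X (msmul X P)) (msmul X P).
  by apply: functional_extensionality_dep => n; rewrite /msadd /mssub subrK.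
apply: (ideal_add Kseq_closed_ideal).
  apply: IH; first exact: Fseq_sub FX (Fseq_mul FX FP).
  by move=> n; case: (hP n).
apply: (ideal_mull Kseq_closed_ideal) => //.
by apply: sub_gen_smallest; split=> // n; case: (hP n).
Qed.

Lemma KseqP X : Kseq X <-> Fseq X /\ rank_approximable X.
Proof.
split; first exact: Kseq_rank_approximable.
move=> [FX aX]; apply: (ideal_closed Kseq_closed_ideal) => // e e0.
(* Half of [e], because closedness asks for a strict inequality. *)
have [r hr] := aX _ (divr_gt0 e0 (ltr0Sn R 1)).
pose K n := s2val (cid2 (hr n)).
have rK n : (\rank (K n) <= r)%N := s2valP (cid2 (hr n)).
have hK n : opnorm (X n - K n) <= e / 2 := s2valP' (cid2 (hr n)).
exists (K : matseq R delta); last first.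
  apply: (@le_lt_trans _ _ (e / 2)).
    exact: supnorm_le.
  by rewrite ltr_pdivrMr // ltr_pMr // ltr1n.
apply: (@bounded_rank_Kseq r); last exact: rK.
(* The approximants are bounded because they stay within [e / 2] of the bounded [X]. *)
have [c hc] := FX; exists (c + e / 2) => n.
have -> : K n = X n - (X n - K n) by rewrite opprB addrC subrK.
apply: (le_trans (ler_opnormD _ _)); rewrite opnormN.
by apply: lerD; [exact: hc | exact: hK].
Qed.

End FixedDimension.

End CompactSequences.

(** * Norm closedness of restricted algebras *)

Section Damping.
Context {R : realType}.
Local Notation C := R[i].

Section Matrix.
Variables (m : nat) (tau : R) (X : 'M[C]_m).

(* X (1 - tau X^* X)^k *)
Definition damp (k : nat) : 'M[C]_m :=
  iter k (fun Z => Z - tau%:C *: (Z *m (X^t* *m X))) X.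

(** Gradient descent with step [tau] for half of |Y v|^2, that is, (1 - tau Y^* Y) v. *)
Definition descent_step (Y : 'M[C]_m) (v : 'cV[C]_m) : 'cV[C]_m :=
  v - tau%:C *: (Y^t* *m (Y *m v)).

(** Moves the damping factors onto the vector, so that norm bounds become estimates along a descent
    trajectory. *)
Lemma damp_mulmx k v : damp k *m v = X *m iter k (descent_step X) v.
Proof.
elim: k v => [//|k IH] v; rewrite iterSr -IH [damp _]/= -/(damp k).
by rewrite /descent_step mulmxBl mulmxBr -scalemxAl -scalemxAr !mulmxA.
Qed.

(** The square expands to |v|^2 - 2 tau |Y v|^2 + tau^2 |Y^* Y v|^2, and smallness of [tau] bounds
    the last term by tau |Y v|^2. *)
Lemma descent_step_sqr (Y : 'M[C]_m) v : 0 <= tau -> tau * opnorm Y ^+ 2 <= 1 ->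
  l2norm (descent_step Y v) ^+ 2 <= l2norm v ^+ 2 - tau * l2norm (Y *m v) ^+ 2.
Proof.
move=> t0 t1; rewrite l2norm_sqr /descent_step.
rewrite !(rdotDl, rdotDr, rdotNl, rdotNr, rdotZl, rdotZr) (rdotC (_ *m _) v).
rewrite -(rdot_adj Y v (Y *m v)) -!l2norm_sqr.
set a := l2norm (Y *m v); set b := l2norm (_ *m (Y *m v)).
have ba : b <= opnorm Y * a.
  apply: (le_trans (opnormP _ _)); apply: ler_wpM2r; first exact: l2norm_ge0.
  exact: opnorm_adj_le.
have b2 : b ^+ 2 <= opnorm Y ^+ 2 * a ^+ 2.
  by rewrite -exprMn lerXn2r ?nnegrE ?mulr_ge0 ?opnorm_ge0 ?l2norm_ge0.
have : tau * (tau * b ^+ 2) <= tau * a ^+ 2.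
  apply: ler_wpM2l => //.
  apply: (@le_trans _ _ (tau * (opnorm Y ^+ 2 * a ^+ 2))).
    exact: ler_wpM2l.
  by rewrite mulrA -[leRHS]mul1r; apply: ler_wpM2r => //; apply: sqr_ge0.
rewrite mulrN opprK.
set x := l2norm v ^+ 2; set y := tau * a ^+ 2; set z := tau * (tau * _) => h.
lra.
Qed.

Hypothesis tau_ge0 : 0 <= tau.
Hypothesis tau_small : tau * opnorm X ^+ 2 <= 1.

Lemma descent_step_le v : l2norm (descent_step X v) <= l2norm v.
Proof.
rewrite -(ler_pXn2r (n := 2)) ?nnegrE ?l2norm_ge0 //.
apply: (le_trans (descent_step_sqr _ tau_ge0 tau_small)).
by rewrite lerBlDr lerDl mulr_ge0 // sqr_ge0.
Qed.

Lemma descent_step_energy v : l2norm (X *m descent_step X v) <= l2norm (X *m v).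
Proof.
have -> : X *m descent_step X v = descent_step (X^t*) (X *m v).
  by rewrite /descent_step trmxCK mulmxBr -scalemxAr !mulmxA.
rewrite -(ler_pXn2r (n := 2)) ?nnegrE ?l2norm_ge0 //.
have adj_small : tau * opnorm (X^t*) ^+ 2 <= 1.
  apply: le_trans tau_small; apply: ler_wpM2l; first exact: tau_ge0.
  by rewrite lerXn2r ?nnegrE ?opnorm_ge0 ?opnorm_adj_le.
apply: (le_trans (descent_step_sqr _ tau_ge0 adj_small)).
by rewrite lerBlDr lerDl mulr_ge0 // sqr_ge0.
Qed.

(* The energies |X v_j|^2 decrease and tau times their sum is at most |v|^2. *)
Lemma descent_energy k v :
  l2norm (iter k (descent_step X) v) ^+ 2 +
    k%:R * tau * l2norm (X *m iter k (descent_step X) v) ^+ 2 <= l2norm v ^+ 2.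
Proof.
elim: k => [|k IH]; first by rewrite !mul0r addr0.
apply: le_trans IH; rewrite iterS; set w := iter k _ v.
have h1 := descent_step_sqr w tau_ge0 tau_small.
have h2 : k.+1%:R * tau * l2norm (X *m descent_step X w) ^+ 2 <=
    k.+1%:R * tau * l2norm (X *m w) ^+ 2.
  apply: ler_wpM2l; first by rewrite mulr_ge0.
  by rewrite lerXn2r ?nnegrE ?l2norm_ge0 ?descent_step_energy.
apply: (@le_trans _ _ (l2norm (descent_step X w) ^+ 2 +
    k.+1%:R * tau * l2norm (X *m w) ^+ 2)); first by rewrite lerD2l.
rewrite -natr1; set a := l2norm (X *m _) ^+ 2 in h1 *.
set b := l2norm _ ^+ 2 in h1 *; set c := l2norm _ ^+ 2 in h1 *.
by rewrite !mulrDl !mul1r; lra.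
Qed.

(** The energy estimate gives k tau |X v_k|^2 <= |v|^2. The resulting bound does not involve the
    norm of [X]. *)
Lemma opnorm_damp_le k (b : R) : 0 <= b -> 1 <= k%:R * tau * b ^+ 2 ->
  opnorm (damp k) <= b.
Proof.
move=> b0 hb; apply: opnorm_le => // v.
rewrite -(ler_pXn2r (n := 2)) ?nnegrE ?mulr_ge0 ?l2norm_ge0 // exprMn.
rewrite damp_mulmx; have := descent_energy k v.
set w := iter _ _ _; set y := l2norm (X *m w) ^+ 2; set x := l2norm v ^+ 2.
have w0 : 0 <= l2norm w ^+ 2 by rewrite sqr_ge0.
have y0 : 0 <= y by rewrite sqr_ge0.
move=> h; have {}h : k%:R * tau * y <= x by lra.
apply: (@le_trans _ _ ((k%:R * tau * b ^+ 2) * y)).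
  by rewrite -[leLHS]mul1r; apply: ler_wpM2r.
have -> : k%:R * tau * b ^+ 2 * y = b ^+ 2 * (k%:R * tau * y) by ring.
by apply: ler_wpM2l => //; apply: sqr_ge0.
Qed.

(** Each of the [k] steps changes X v_j by tau X X^* X v_j, of norm at most tau c^3 |v|. *)
Lemma opnorm_sub_damp_le k (c : R) : opnorm X <= c ->
  opnorm (X - damp k) <= k%:R * tau * c ^+ 3.
Proof.
move=> Xc; have c0 : 0 <= c := le_trans (opnorm_ge0 X) Xc.
apply: opnorm_le => [|v]; first by rewrite !mulr_ge0 // exprn_ge0.
have mulXc (Y : 'M[C]_m) u a : opnorm Y <= c -> l2norm u <= a ->
    l2norm (Y *m u) <= c * a.
  move=> Yc ua; apply: (le_trans (opnormP _ _)).
  by apply: ler_pM => //; [exact: opnorm_ge0 | exact: l2norm_ge0].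
have le_v j : l2norm (iter j (descent_step X) v) <= l2norm v.
  by elim: j => [//|j IH]; apply: le_trans (descent_step_le _) IH.
rewrite mulmxBl damp_mulmx; elim: k => [|k IH].
  by rewrite subrr l2norm0 !mul0r.
rewrite iterS; set w := iter k _ v in IH *.
have -> : X *m v - X *m descent_step X w =
    (X *m v - X *m w) + tau%:C *: (X *m (X^t* *m (X *m w))).
  by rewrite /descent_step mulmxBr -scalemxAr opprB addrA [in RHS]addrAC.
apply: (le_trans (ler_l2normD _ _)).
have -> : k.+1%:R * tau * c ^+ 3 * l2norm v =
    k%:R * tau * c ^+ 3 * l2norm v + tau * (c * (c * (c * l2norm v))).
  by rewrite -natr1; ring.
apply: lerD; first exact: IH.
rewrite l2normZ normc_real //; apply: ler_wpM2l => //.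
apply: (mulXc _ _ _ Xc); apply: (mulXc).
  exact: le_trans (opnorm_adj_le _) Xc.
by apply: (mulXc _ _ _ Xc); apply: le_v.
Qed.

End Matrix.

Section Restriction.
Variables (delta eta : nat -> nat) (A : set (matseq R delta)).
Hypothesis A_cstar : cstar_subalgebra A.

Lemma cstar_mssub X Y : A X -> A Y -> A (mssub X Y).
Proof.
move=> AX AY.
have -> : mssub X Y = msadd X (msscale (-1) Y).
  apply: functional_extensionality_dep => n.
  by rewrite /msadd /msscale scaleN1r.
by apply: (cstar_add A_cstar) => //; apply: (cstar_scale A_cstar).
Qed.

(** The iteration starts at [X] and uses only products, adjoints, scalars and differences, so it
    stays in an algebra that may lack a unit. *)
Lemma cstar_damp tau X k : A X -> A (fun n => damp tau (X n) k).
Proof.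
move=> AX; elim: k => [//|k IH].
apply: (cstar_mssub IH); apply: (cstar_scale A_cstar).
apply: (cstar_mul A_cstar) => //; apply: (cstar_mul A_cstar) => //.
exact: cstar_adj.
Qed.

Lemma lift_bounded X (c : R) : A X -> 0 < c ->
  (forall n, opnorm (X (eta n)) <= c) ->
  exists2 X', A X' & (forall n, opnorm (X' n) <= 2 * c) /\
                     (forall n, opnorm (X (eta n) - X' (eta n)) <= c / 4).
Proof.
move=> AX c0 Xc; have [M hM] := cstar_sub A_cstar AX.
have M0 : 0 <= M := le_trans (opnorm_ge0 _) (hM 0%N).
have c2 : 0 < 4 * c ^+ 2 by rewrite mulr_gt0 // exprn_gt0.
(* Large enough that [tau * M ^+ 2 <= 1], so one [tau] suits all entries; the successor makes [k]
   positive. *)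
pose k := (Num.bound (M ^+ 2 / (4 * c ^+ 2))).+1.
have k0 : 0 < k%:R :> R by rewrite ltr0n.
(* The product of [k] and [tau] is 1 / (4 c^2): this gives the bound 2 c everywhere and the error c
   / 4 along [eta]. *)
pose tau := (k%:R * (4 * c ^+ 2))^-1.
have tau0 : 0 < tau by rewrite invr_gt0 mulr_gt0.
have ktau : k%:R * tau = (4 * c ^+ 2)^-1.
  by rewrite /tau invfM mulrA mulfV ?gt_eqF // mul1r.
have tauM : tau * M ^+ 2 <= 1.
  rewrite mulrC ler_pdivrMr ?mulr_gt0 // mul1r -ler_pdivrMr //.
  apply: ltW; apply: (@lt_trans _ _ (Num.bound (M ^+ 2 / (4 * c ^+ 2)))%:R).
    by apply: archi_boundP; rewrite divr_ge0 ?sqr_ge0 // ltW.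
  by rewrite ltr_nat.
have tau_small n : tau * opnorm (X n) ^+ 2 <= 1.
  apply: le_trans tauM; apply: ler_wpM2l; first exact: ltW.
  by rewrite lerXn2r ?nnegrE ?opnorm_ge0 ?hM.
exists (fun n => damp tau (X n) k); first exact: cstar_damp.
split=> n.
  apply: opnorm_damp_le (ltW tau0) (tau_small n) _ _ _ _.
    by rewrite mulr_ge0 // ltW.
  by rewrite ktau exprMn -natrX mulVf // gt_eqF.
apply: (le_trans (opnorm_sub_damp_le (ltW tau0) (tau_small _) k (Xc n))).
rewrite ktau le_eqVlt; apply/orP; left; apply/eqP; field.
by rewrite gt_eqF.
Qed.

End Restriction.

End Damping.

(** * Lifting limits along a restriction *)

Section RestrictedAlgebra.
Context {R : realType}.
Variables (delta eta : nat -> nat) (A : set (matseq R delta)).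
Hypothesis A_cstar : cstar_subalgebra A.

Lemma Fseq_restr (nu : nat -> nat) (X : matseq R delta) :
  Fseq X -> Fseq (restr nu X).
Proof. by case=> c hc; exists c => n; apply: hc. Qed.

Lemma geometric_small (c d : R) : 0 <= c -> 0 < d ->
  exists k, forall l, (k <= l)%N -> c / 2 ^+ l < d.
Proof.
move=> c0 d0; exists (Num.bound (c / d)) => l kl.
rewrite ltr_pdivrMr ?exprn_gt0 // mulrC -ltr_pdivrMr //.
apply: (lt_le_trans (archi_boundP (divr_ge0 c0 (ltW d0)))).
by rewrite -natrX ler_nat (leq_trans kl) // ltnW // ltn_expl.
Qed.

Variable Y : matseq R (delta \o eta).
Hypothesis Y_limit : forall e : R, 0 < e ->
  exists2 Z, (restr eta @` A) Z & forall n, opnorm (Y n - Z n) <= e.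

Definition lifts_up_to (c : R) (S : matseq R delta) : Prop :=
  A S /\ forall n, opnorm (Y n - S (eta n)) <= c.

(** The damped correction is small at every index, not only along [eta], so successive lifts
    converge uniformly. *)
Lemma lift_improvement (c : R) S : 0 < c -> lifts_up_to c S ->
  exists S', lifts_up_to (c / 2) S' /\ forall n, opnorm (S n - S' n) <= 3 * c.
Proof.
move=> c0 [AS hS].
(* With c / 8, the difference Z - S is at most 9 c / 8 <= 5 c / 4 along [eta]; its lift is at most 5
   c / 2 <= 3 c everywhere and leaves the error c / 8 + 5 c / 16 <= c / 2. *)
have [|_ [Z AZ <-] hZ] := Y_limit (e := c / 8); first by rewrite divr_gt0.
have ZS n : opnorm (mssub Z S (eta n)) <= 5 / 4 * c.
  apply: (le_trans (ler_opnormB _ (Y n) _)); rewrite opnormBC.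
  apply: (@le_trans _ _ (c / 8 + c)); last lra.
  by apply: lerD; [exact: hZ | exact: hS].
have c54 : 0 < 5 / 4 * c by lra.
have [W AW [W2 W4]] := lift_bounded A_cstar (cstar_mssub A_cstar AZ AS) c54 ZS.
exists (msadd S W); split; last first.
  move=> n; rewrite /msadd opprD addrA subrr sub0r opnormN.
  by apply: (le_trans (W2 n)); lra.
split; first exact: (cstar_add A_cstar).
move=> n; apply: (le_trans (ler_opnormB _ (Z (eta n)) _)).
apply: (@le_trans _ _ (c / 8 + 5 / 4 * c / 4)); last lra.
by apply: lerD; [exact: hZ | move: (W4 n); rewrite /mssub /msadd opprD addrA].
Qed.

Lemma limit_of_lifts (c : R) : 0 < c -> lifts_up_to c mszero ->
  Fseq Y -> (restr eta @` A) Y.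
Proof.
move=> c0 hz FY.
have ck k : 0 < c / 2 ^+ k by rewrite divr_gt0 ?exprn_gt0.
(* Putting the hypothesis inside the existential lets [choice] yield a total function, with default
   value [S]. *)
have next (kS : nat * matseq R delta) : exists S',
    lifts_up_to (c / 2 ^+ kS.1) kS.2 -> lifts_up_to (c / 2 ^+ kS.1.+1) S' /\
    forall n, opnorm (kS.2 n - S' n) <= 3 * (c / 2 ^+ kS.1).
  case: kS => k S /=; have [hS|nS] := pselect (lifts_up_to (c / 2 ^+ k) S).
    have [S' hS'] := lift_improvement (ck k) hS; exists S' => _.
    have -> : c / 2 ^+ k.+1 = c / 2 ^+ k / 2 by rewrite exprSr invfM mulrA.
    exact: hS'.
  by exists S => /nS.
have [F hF] := choice next.
pose S_ := fix S_ k := if k is k'.+1 then F (k', S_ k') else mszero.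
have hS k : lifts_up_to (c / 2 ^+ k) (S_ k).
  elim: k => [|k IH]; first by rewrite expr0 divr1.
  exact: (hF (k, S_ k) IH).1.
have dS k n : opnorm (S_ k n - S_ k.+1 n) <= 3 * (c / 2 ^+ k).
  exact: (hF (k, S_ k) (hS k)).2.
(* The tail from [k] on of the series with terms 3 c / 2^l. *)
pose e k := 6 * c / 2 ^+ k.
have eS k : e k = e k.+1 + 3 * (c / 2 ^+ k).
  by rewrite /e exprS; field; rewrite expf_neq0 // pnatr_eq0.
have e_ge0 k : 0 <= e k by rewrite /e -mulrA mulr_ge0 // ltW.
have cauchy n k l : (k <= l)%N -> opnorm (S_ k n - S_ l n) <= e k.
  (* The sharper bound [e k - e l] telescopes in the induction on [l]. *)
  move=> kl; suff : opnorm (S_ k n - S_ l n) <= e k - e l.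
    by move/le_trans; apply; rewrite lerBlDr lerDl.
  elim: l kl => [|l IH].
    by rewrite leqn0 => /eqP->; rewrite !subrr opnorm0.
  rewrite leq_eqVlt => /predU1P[<-|]; first by rewrite !subrr opnorm0.
  rewrite ltnS => kl; apply: (le_trans (ler_opnormB _ (S_ l n) _)).
  apply: (@le_trans _ _ ((e k - e l) + 3 * (c / 2 ^+ l))).
    by apply: lerD; [exact: IH | exact: dS].
  by have := eS l; set x := 3 * _ => h; lra.
have e_small (d : R) : 0 < d -> exists k, forall l, (k <= l)%N -> e l < d.
  by apply: geometric_small; rewrite mulr_ge0 // ltW.
pose L n := sval (cid (matrix_seq_lim e_small (cauchy n))).
have hL n k : opnorm (S_ k n - L n) <= e k.
  exact: (svalP (cid (matrix_seq_lim e_small (cauchy n)))).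
have FL : Fseq (L : matseq R delta).
  (* The lifts start at the zero sequence, so [e 0] bounds the limit. *)
  exists (e 0%N) => n; have := hL n 0%N.
  by rewrite /= /mszero sub0r opnormN.
have AL : A L.
  apply: (cstar_closed A_cstar) => // d d0.
  have [k hk] := e_small _ d0; exists (S_ k); first by case: (hS k).
  apply: le_lt_trans (hk k (leqnn k)); apply: supnorm_le => n.
  by rewrite /mssub opnormBC; apply: hL.
exists L => //; apply: functional_extensionality_dep => n.
apply/eqP; rewrite -subr_eq0; apply/eqP/matrixP => i j; rewrite [RHS]mxE.
apply: ComplexField.Normc.eq0_normc; apply/le_anti; rewrite normc_ge0 andbT.
apply/ler_addgt0Pr => d d0; rewrite add0r.
apply: (le_trans (normc_entry_le _ _ _)).
(* 7 = 1 + 6: the error c / 2^k of the lift along [eta] plus its distance [e k] to the limit. *)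
have [k hk] := geometric_small (c := 7 * c) (mulr_ge0 (ler0n _ 7) (ltW c0)) d0.
apply: le_trans (ltW (hk k (leqnn k))).
rewrite opnormBC; apply: (le_trans (ler_opnormB _ (S_ k (eta n)) _)).
have -> : 7 * c / 2 ^+ k = c / 2 ^+ k + e k by rewrite /e; ring.
by apply: lerD; [exact: (hS k).2 | exact: hL].
Qed.

End RestrictedAlgebra.

Lemma restr_cstar_subalgebra (R : realType) (delta eta : nat -> nat)
    (A : set (matseq R delta)) :
  cstar_subalgebra A -> cstar_subalgebra (restr eta @` A).
Proof.
move=> Ac; split.
- by move=> _ [X AX <-]; apply: Fseq_restr; apply: (cstar_sub Ac).
- by exists mszero => //; apply: cstar_zero.
- by move=> _ _ [X AX <-] [Y AY <-]; exists (msadd X Y) => //; apply: cstar_add.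
- by move=> c _ [X AX <-]; exists (msscale c X) => //; apply: cstar_scale.
- by move=> _ _ [X AX <-] [Y AY <-]; exists (msmul X Y) => //; apply: cstar_mul.
- by move=> _ [X AX <-]; exists (msadj X) => //; apply: cstar_adj.
- move=> Y FY hY; have [c hc] := FY.
  (* Zero is the first lift, with the bound on [Y] as its error; adding 1 makes this error
     positive. *)
  have c1 : 0 < c + 1 by rewrite ltr_wpDl // (le_trans _ (hc 0%N)) ?opnorm_ge0.
  apply: (limit_of_lifts Ac _ c1 _ FY).
    move=> e e0; have [_ [Z AZ <-] hZ] := hY e e0; exists (restr eta Z).
      by exists Z.
    move=> n; apply: le_trans (ltW hZ).
    apply: (opnorm_le_supnorm (X := mssub Y (restr eta Z))).
    by apply: Fseq_sub FY _; apply: Fseq_restr; apply: (cstar_sub Ac).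
  split; first exact: cstar_zero.
  by move=> n; rewrite /mszero subr0 (le_trans (hc n)) // lerDl.
Qed.

(** * The diagonal subsequence *)

Section DiagonalSubsequence.

Definition infinitely_often (S : nat -> Prop) : Prop :=
  forall N, exists2 n, (N <= n)%N & S n.

(** Infinite sets [S_ k] decrease, each step keeping the half where [P k] holds if it is infinite
    and the other half if not; [eta k] is picked in [S_ k]. *)
Lemma eventually_decided (P : nat -> nat -> Prop) :
  exists2 eta, strictly_increasing eta & forall j,
    exists N, (forall n, (N <= n)%N -> P j (eta n)) \/
              (forall n, (N <= n)%N -> ~ P j (eta n)).
Proof.
pose refine (S : nat -> Prop) j : nat -> Prop :=
  if `[< infinitely_often (fun n => S n /\ P j n) >]
  then fun n => S n /\ P j n else fun n => S n /\ ~ P j n.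
pose S_ := fix S_ k : nat -> Prop :=
  if k is k'.+1 then refine (S_ k') k' else fun=> True.
have Sinf k : infinitely_often (S_ k).
  elim: k => [|k IH] /=; first by move=> N; exists N.
  (* In the second case no member of [S_ k] from some [N0] on satisfies [P k]. *)
  rewrite /refine; case: asboolP => // /existsNP[N0 hN0] N.
  have [n] := IH (maxn N N0); rewrite geq_max => /andP[Nn N0n] Sn.
  by exists n => //; split=> // Pn; apply: hN0; exists n.
have Sdecr k l n : (k <= l)%N -> S_ l n -> S_ k n.
  elim: l => [|l IH]; first by rewrite leqn0 => /eqP->.
  rewrite leq_eqVlt => /predU1P[->//|]; rewrite ltnS => kl Sl; apply: IH => //.
  by move: Sl; rewrite /= /refine; case: asboolP => _ [].
pose pick k N := s2val (cid2 (Sinf k N)).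
have pick_ge k N : (N <= pick k N)%N := s2valP (cid2 (Sinf k N)).
have pickS k N : S_ k (pick k N) := s2valP' (cid2 (Sinf k N)).
pose eta := fix eta k :=
  if k is k'.+1 then pick k (eta k').+1 else pick 0%N 0%N.
have etaS k : S_ k (eta k) by case: k => [|k]; apply: pickS.
exists eta => [|j].
  apply: (@homo_ltn _ eta (fun a b => (a < b)%N)) => [? ? ?|k].
    exact: ltn_trans.
  exact: pick_ge.
(* [P j] is decided on [S_ j.+1], not yet on [S_ j]. *)
exists j.+1.
case E: `[< infinitely_often (fun n => S_ j n /\ P j n) >]; [left|right];
  move=> n jn; have := Sdecr _ _ _ jn (etaS n);
  by rewrite /= /refine E; case.
Qed.

End DiagonalSubsequence.

(** * A subsequence that reflects compactness *)

Section Separable.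
Context {R : realType} {delta : nat -> nat}.
Variable A : set (matseq R delta).
Hypothesis A_cstar : cstar_subalgebra A.
Hypothesis A_separable : separable A.

Definition near_rank (X : matseq R delta) (r : nat) (e : R) (n : nat) : Prop :=
  exists2 K : 'M[R[i]]_(delta n), (\rank K <= r)%N & opnorm (X n - K) <= e.

Lemma near_rank_perturb X Y r (d e : R) n :
  opnorm (Y n - X n) <= d -> near_rank X r e n -> near_rank Y r (d + e) n.
Proof.
move=> YX [K rK hK]; exists K => //.
by apply: (le_trans (ler_opnormB _ (X n) _)); apply: lerD.
Qed.

Lemma compactness_reflecting_subsequence :
  exists2 eta, strictly_increasing eta & forall X nu, A X ->
    strictly_increasing nu -> Kseq (restr nu (restr eta X)) ->
    Kseq (restr eta X).
Proof.
have [D [/countable_injP[f finj] DA Ddense]] := A_separable.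
(* Countability of [D] lets one natural number encode a triple of sequence, rank and tolerance. *)
pose P j n := exists X r q, [/\ D X, j = pickle (f X, r, q)
                              & near_rank X r (q.+1%:R^-1) n].
have PE X r q n : D X ->
    P (pickle (f X, r, q)) n <-> near_rank X r (q.+1%:R^-1) n.
  move=> DX; split=> [[X' [r' [q' [DX' /(pcan_inj pickleK)[fX -> ->]]]]]|h].
    by have -> : X' = X by apply: finj; rewrite ?inE.
  by exists X, r, q.
have [eta eta_incr decided] := eventually_decided P.
exists eta => // X nu AX nu_incr /KseqP[_ compact]; apply/KseqP; split.
  by apply: Fseq_restr; apply: (cstar_sub A_cstar).
move=> e e0.
(* Then [d <= e / 2]. Replacing [X] by [Y] and returning costs d / 2 each way around the tolerance d
   / 2, in total 3 d / 2 <= e. *)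
pose q := Num.bound (2 / e); pose d : R := q.+1%:R^-1.
have d0 : 0 < d by rewrite invr_gt0.
have de : d <= e / 2.
  rewrite -(invf_div 2) lef_pV2 ?posrE ?divr_gt0 //.
  apply: (le_trans (ltW (archi_boundP _))); first by rewrite divr_ge0 // ltW.
  by rewrite ler_nat.
have d20 : 0 < d / 2 by rewrite divr_gt0.
have [Y DY XY] := Ddense X AX _ d20.
have {}XY n : opnorm (X n - Y n) <= d / 2.
  apply: le_trans (ltW XY); apply: (opnorm_le_supnorm (X := mssub X Y)).
  by apply: Fseq_sub; apply: (cstar_sub A_cstar) => //; apply: DA.
have [r hr] := compact _ d20.
have often n : near_rank Y r d (eta (nu n)).
  rewrite [d]splitr; apply: (near_rank_perturb (X := X)); last exact: hr.
  by rewrite opnormBC.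
have [N []] := decided (pickle (f Y, r, q)) => hN; last first.
  (* The index [nu N] lies in the tail where the predicate would fail, against [often]. *)
  have nuN : (N <= nu N)%N.
    elim: (N) => [//|k IH]; apply: leq_ltn_trans IH _; exact: nu_incr.
  by case: (hN _ nuN); apply/PE.
(* The first [N] entries approximate themselves, with rank at most their size. *)
exists (r + \max_(n < N) delta (eta n))%N => n.
have [nN|Nn] := ltnP n N.
  exists (X (eta n)); last by rewrite subrr opnorm0 ltW.
  apply: (leq_trans (rank_leq_row _)); apply: leq_trans (leq_addl _ _).
  exact: (leq_bigmax (Ordinal nN)).
have /(PE _ _ _ _ DY)/(near_rank_perturb (XY (eta n)))[K rK hK] := hN n Nn.
exists K; first exact: leq_trans rK (leq_addr _ _).
apply: (le_trans hK); rewrite -/d; lra.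
Qed.

End Separable.

(** * From reflected compactness to essential fractality *)

Lemma coset_eq (R : realType) (delta : nat -> nat) (I : set (matseq R delta))
    (X Y : matseq R delta) :
  (forall Z Z', I Z -> I Z' -> I (msadd Z Z')) ->
  I (mssub X Y) -> I (mssub Y X) -> coset I X = coset I Y.
Proof.
move=> ID XY YX; apply/seteqP; split=> _ [Z IZ <-].
  exists (msadd (mssub X Y) Z); first exact: ID.
  apply: functional_extensionality_dep => n.
  by rewrite /msadd /mssub addrA addrCA subrr addr0.
exists (msadd (mssub Y X) Z); first exact: ID.
apply: functional_extensionality_dep => n.
by rewrite /msadd /mssub addrA addrCA subrr addr0.
Qed.

Lemma restr_Kseq (R : realType) (delta nu : nat -> nat) (X : matseq R delta) :
  Kseq X -> Kseq (restr nu X).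
Proof.
move=> /KseqP[FX aX]; apply/KseqP; split; first exact: Fseq_restr.
by move=> e /aX[r hr]; exists r => n; apply: hr.
Qed.

(** If two members agree along [nu], their difference restricts to zero, which is compact, so by
    reflection it is compact: the restriction determines the coset. *)
Lemma compactness_reflecting_essentially_fractal (R : realType)
    (delta : nat -> nat) (B : set (matseq R delta)) :
  cstar_subalgebra B ->
  (forall X nu, B X -> strictly_increasing nu -> Kseq (restr nu X) -> Kseq X) ->
  essentially_fractal B.
Proof.
move=> Bc reflect; split=> // nu nu_incr; last first.
  apply/seteqP; split=> [_ [X [BX KX] <-]|_ [[X BX <-] KX]].
    by split; [exists X | apply: restr_Kseq].
  by exists X => //; split=> //; apply: reflect KX.
set I := B `&` _.
have ID Z Z' : I Z -> I Z' -> I (msadd Z Z').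
  move=> [BZ KZ] [BZ' KZ']; split; first exact: cstar_add.
  exact: (ideal_add (Kseq_closed_ideal _)).
have Isub X X' : B X -> B X' -> restr nu X = restr nu X' -> I (mssub X X').
  move=> BX BX' XX'; have BXX' : B (mssub X X') by apply: cstar_mssub.
  split=> //; apply: reflect BXX' nu_incr _.
  have -> : restr nu (mssub X X') = mssub (restr nu X) (restr nu X') by [].
  rewrite XX'; have -> : mssub (restr nu X') (restr nu X') = mszero.
    by apply: functional_extensionality_dep => n; rewrite /mssub subrr.
  exact: (ideal_zero (Kseq_closed_ideal _)).
(* Off the restrictions of members of [B], the map takes the default value [set0]. *)
have [Z|W hW] := @choice _ (set (matseq R delta))
    (fun Z W => forall X, B X -> restr nu X = Z -> coset I X = W).
  have [[X [BX XZ]]|nX] := pselect (exists X, B X /\ restr nu X = Z).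
    exists (coset I X) => X' BX' X'Z.
    by apply: coset_eq => //; apply: Isub => //; rewrite XZ.
  by exists set0 => X BX XZ; case: nX; exists X.
exists W; split=> [_ [X BX <-]|X BX]; last exact: hW.
by exists X => //; apply: hW.
Qed.

Theorem theorem25 (R : realType) (delta : nat -> nat)
    (delta_gt0 : forall n : nat, (0 < delta n)%N)
    (A : set (matseq R delta)) (A_cstar : cstar_subalgebra A)
    (A_separable : separable A) :
  exists eta : nat -> nat,
    strictly_increasing eta /\ essentially_fractal (restr eta @` A).
Proof.
have [eta eta_incr reflect] :=
  compactness_reflecting_subsequence A_cstar A_separable.
exists eta; split=> //; apply: compactness_reflecting_essentially_fractal.
  exact: restr_cstar_subalgebra.
by move=> _ nu [X AX <-]; apply: reflect.
Qed.
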